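(* Let $B$ be a topological space and let $f:E\to X$ be a fibrewise map over $B$. Assume that either $E$ and $X$ are normal spaces, or $f$ is a closed fibrewise cofibration and $X$ is normal. Then for every integer $n\ge 0$ the following statements are equivalent: (i) $\mathrm{secat}_B(f)\le n$; (ii) the diagonal map $\Delta_{n+1}:X\to\prod^{n+1}_B X$ factors up to fibrewise homotopy through the fibrewise sectional $n$-fat wedge, i.e. there is a fibrewise map $\varphi:X\to T^n_B(f)$ with $j_n\circ\varphi\simeq_B\Delta_{n+1}$; (iii) the $n$-th fibrewise Ganea map $p_n:G^n_B(f)\to X$ admits a fibrewise homotopy section, i.e. there is a fibrewise map $\sigma:X\to G^n_B(f)$ with $p_n\circ\sigma\simeq_B \mathrm{id}_X$.
   Context: Fix a space $B$. A fibrewise space over $B$ is a space $X$ with a map $p_X:X\to B$; a fibrewise map $f:X\to Y$ is a map with $p_Yf=p_X$. The fibrewise product is $X\times_BY=\{(x,y):p_X(x)=p_Y(y)\}$ with the evident projection, and $\prod^n_BX$ is the $n$-fold fibrewise product; $\Delta_{n+1}(x)=(x,\dots,x)$. The fibrewise cylinder $I_B(X)$ is $X\times[0,1]$ with projection $(x,t)\mapsto p_X(x)$; a fibrewise homotopy is a fibrewise map $I_B(X)\to Y$, and $f\simeq_B g$ means fibrewise homotopic. A fibrewise map $j:A\to X$ is a fibrewise cofibration if for every fibrewise map $g:X\to Y$ and fibrewise homotopy $H:I_B(A)\to Y$ with $H(a,0)=gj(a)$ there is a fibrewise homotopy $\tilde H:I_B(X)\to Y$ with $\tilde H(x,0)=g(x)$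 and $\tilde H(j(a),t)=H(a,t)$; such $j$ is an embedding, and it is a closed fibrewise cofibration if $j(A)$ is closed in $X$. Fibrewise sectional category: an open set $U\subseteq X$ is fibrewise sectional for $f:E\to X$ if there is a fibrewise map $s:U\to E$ with $f\circ s\simeq_B$ the inclusion $U\hookrightarrow X$ (fibrewise homotopy of maps $U\to X$). $\mathrm{secat}_B(f)$ is the least $n$ such that $X$ is covered by $n+1$ fibrewise sectional open sets ($\infty$ if none). Fibrewise join: for fibrewise maps $h:Y\to K$, $k:Z\to K$ let $P_B(K)=\{(b,\theta)\in B\times K^{[0,1]}: p_K(\theta(s))=b\ \forall s\}$ and $E_{h,k}=\{(y,(b,\theta),z)\in Y\times P_B(K)\times Z: h(y)=\theta(0),\ k(z)=\theta(1)\}$, projecting to $b$. The fibrewise join $Y*_KZ$ is the quotient of $Y\sqcup (E_{h,k}\times[0,1])\sqcup Z$ by $(y,(b,\theta),z,0)\sim y$, $(y,(b,\theta),z,1)\sim z$, with the induced projection to $B$, together with the fibrewise map $Y*_KZ\to K$ given by $h$ on $Y$, $k$ on $Z$ and $(y,(b,\theta),z,t)\mapsto\theta(t)$ (the join map). Fibrewise sectional $n$-fat wedge: $T^0_B(f)=E$, $j_0=f$; for $n\ge1$, $j_n:T^n_B(f)\to\prod^{n+1}_BX$ is the join map of the fibrewise join of $f\times_B\mathrm{id}:E\times_B\prod^n_BX\to\prod^{n+1}_BX$ and $\mathrm{id}_X\times_Bj_{n-1}:X\times_BT^{n-1}_B(f)\to\prod^{n+1}_BX$. Fibrewise Ganea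 maps: $G^0_B(f)=E$, $p_0=f$; for $n\ge1$, $G^n_B(f)$ is the fibrewise join of $p_{n-1}:G^{n-1}_B(f)\to X$ and $f:E\to X$, and $p_n:G^n_B(f)\to X$ is its join map. *)

(* Defs.v *)
From HB Require Import structures.
From mathcomp Require Import all_boot all_order all_algebra generic_quotient.
From mathcomp Require Import all_classical all_reals all_analysis.

Set Implicit Arguments.
Unset Strict Implicit.
Unset Printing Implicit Defensive.

Import Order.TTheory GRing.Theory Num.Theory.
Import numFieldNormedType.Exports.
Local Open Scope classical_set_scope.
Local Open Scope ring_scope.
Local Open Scope quotient_scope.

Section Fibrewise.
Variables (R : realType) (B : topologicalType).

Definition uI : topologicalType :=
  Topological.clone (set_type (`[0, 1]%classic : set R)) _.

Lemma uI0_subproof : (0 : R) \in (`[0, 1]%classic : set R).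
Proof. by apply: mem_set; rewrite /= in_itv /= lexx ler01. Qed.
Lemma uI1_subproof : (1 : R) \in (`[0, 1]%classic : set R).
Proof. by apply: mem_set; rewrite /= in_itv /= lexx ler01. Qed.
Definition i0 : uI := exist _ 0 uI0_subproof.
Definition i1 : uI := exist _ 1 uI1_subproof.

(** Fibrewise spaces over B: a space with a projection to B
    (continuity of the projection is assumed explicitly where needed). *)
Record fsp := FSp { fsp_car :> topologicalType; fsp_proj : fsp_car -> B }.

(** Functions commuting with the projections (used as data to build the
    constructions; continuity is required separately). *)
Record fhom (X Y : fsp) := FHom {
  fhom_fun :> X -> Y;
  fhom_projP : forall x, fsp_proj (fhom_fun x) = fsp_proj x }.

Definition fibrewise_map (X Y : fsp) (g : X -> Y) :=
  continuous g /\ forall x, fsp_proj (g x) = fsp_proj x.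

Definition fhtpy (X Y : fsp) (g0 g1 : X -> Y) :=
  exists H : (X * uI)%type -> Y,
    [/\ continuous H,
        (forall x t, fsp_proj (H (x, t)) = fsp_proj x),
        (forall x, H (x, i0) = g0 x) &
        (forall x, H (x, i1) = g1 x)].

Definition fprod_set (X Y : fsp) : set (fsp_car X * fsp_car Y)%type :=
  [set p | fsp_proj p.1 = fsp_proj p.2].

Definition fprod (X Y : fsp) : fsp :=
  @FSp (Topological.clone (set_type (@fprod_set X Y)) _)
       (fun p => fsp_proj (val p).1).

Lemma fprod_setP (X Y : fsp) (p : set_type (@fprod_set X Y)) :
  fsp_proj (val p).1 = fsp_proj (val p).2.
Proof. exact: (set_mem (valP p)). Qed.

(** fprodn X n is the (n+1)-fold fibrewise product  prod^{n+1}_B X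
    = X x_B (X x_B ( ... x_B X)). *)
Fixpoint fprodn (X : fsp) (n : nat) : fsp :=
  match n with 0 => X | n'.+1 => fprod X (fprodn X n') end.

Fixpoint diag_sig (X : fsp) (n : nat) :
    {d : X -> fprodn X n | forall x, fsp_proj (d x) = fsp_proj x} :=
  match n return {d : X -> fprodn X n | forall x, fsp_proj (d x) = fsp_proj x}
  with
  | 0 => exist _ id (fun x => erefl)
  | n'.+1 =>
      let: exist d dP := diag_sig X n' in
      exist _ (fun x => exist _ (x, d x) (mem_set (esym (dP x))) : fprodn X n'.+1)
              (fun x => erefl)
  end.

Definition diag (X : fsp) (n : nat) : X -> fprodn X n := sval (diag_sig X n).

Definition fhom_times_id (X Y P : fsp) (g : fhom X Y) :
    fprod X P -> fprod Y P :=
  fun p => exist _ (g (val p).1, (val p).2)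
             (mem_set (etrans (fhom_projP g _) (fprod_setP p))).

Definition fhom_times_idP (X Y P : fsp) (g : fhom X Y) :
  forall p, fsp_proj (@fhom_times_id X Y P g p) = fsp_proj p.
Proof. by move=> p; rewrite /= fhom_projP. Qed.

Definition fhom_times_id_fhom (X Y P : fsp) (g : fhom X Y) :
  fhom (fprod X P) (fprod Y P) := FHom (@fhom_times_idP X Y P g).

Definition id_times_fhom (P X Y : fsp) (g : fhom X Y) :
    fprod P X -> fprod P Y :=
  fun p => exist _ ((val p).1, g (val p).2)
             (mem_set (etrans (fprod_setP p) (esym (fhom_projP g _)))).

Definition id_times_fhomP (P X Y : fsp) (g : fhom X Y) :
  forall p, fsp_proj (@id_times_fhom P X Y g p) = fsp_proj p.
Proof. by []. Qed.

Definition id_times_fhom_fhom (P X Y : fsp) (g : fhom X Y) :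
  fhom (fprod P X) (fprod P Y) := FHom (@id_times_fhomP P X Y g).

Definition pathB_set (K : fsp) : set (B * {compact-open, uI -> K})%type :=
  [set p | continuous p.2 /\ forall s, fsp_proj (p.2 s) = p.1].

Definition pathB (K : fsp) : topologicalType :=
  Topological.clone (set_type (@pathB_set K)) _.

Lemma pathB_projP (K : fsp) (p : pathB K) s :
  fsp_proj ((val p).2 s) = (val p).1.
Proof. by case: (set_mem (valP p)) => _; apply. Qed.

Section Join.
Variables (Y Z K : fsp) (h : fhom Y K) (k : fhom Z K).

Definition Ehk_set : set (Y * (pathB K * Z))%type :=
  [set u | h u.1 = (val u.2.1).2 i0 /\ k u.2.2 = (val u.2.1).2 i1].

Definition Ehk : topologicalType := Topological.clone (set_type Ehk_set) _.

Definition Ehk_y (e : Ehk) : Y := (val e).1.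
Definition Ehk_z (e : Ehk) : Z := (val e).2.2.
Definition Ehk_b (e : Ehk) : B := (val (val e).2.1).1.
Definition Ehk_theta (e : Ehk) : uI -> K := (val (val e).2.1).2.

Definition join_piece (o : option bool) : topologicalType :=
  match o with
  | Some true => Y
  | Some false => Z
  | None => Topological.clone (Ehk * uI)%type _
  end.

Definition join_sum : topologicalType :=
  Topological.clone {o : option bool & join_piece o} _.

Definition join_rep (x : join_sum) : join_sum :=
  match x with
  | existT o m =>
    match o return join_piece o -> join_sum with
    | None => fun m =>
        if val m.2 == 0 then existT join_piece (Some true) (Ehk_y m.1)
        else if val m.2 == 1 then existT join_piece (Some false) (Ehk_z m.1)
        else existT join_piece None m
    | Some b => fun m => existT join_piece (Some b) m
    end m
  end.

Definition join_rel_fun (a b : join_sum) := join_rep a == join_rep b.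

Lemma join_rel_refl : reflexive join_rel_fun.
Proof. by move=> a; rewrite /join_rel_fun eqxx. Qed.
Lemma join_rel_sym : symmetric join_rel_fun.
Proof. by move=> a b; rewrite /join_rel_fun eq_sym. Qed.
Lemma join_rel_trans : transitive join_rel_fun.
Proof. by move=> b a c; rewrite /join_rel_fun => /eqP -> /eqP ->. Qed.

Definition join_rel :=
  EquivRel join_rel_fun join_rel_refl join_rel_sym join_rel_trans.

Definition join_quot := {eq_quot join_rel}.
Definition join_car : topologicalType :=
  Topological.clone (quotient_topology join_quot) _.

Definition join_proj_rep (x : join_sum) : B :=
  match x with
  | existT o m =>
    match o return join_piece o -> B with
    | Some true => fun y => fsp_proj (y : Y)
    | Some false => fun z => fsp_proj (z : Z)
    | None => fun m => Ehk_b m.1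
    end m
  end.

Definition join_map_rep (x : join_sum) : K :=
  match x with
  | existT o m =>
    match o return join_piece o -> K with
    | Some true => fun y => h y
    | Some false => fun z => k z
    | None => fun m => Ehk_theta m.1 m.2
    end m
  end.

Lemma join_map_repP x : fsp_proj (join_map_rep x) = join_proj_rep x.
Proof.
case: x => -[[]|] m /=; rewrite ?fhom_projP //.
exact: pathB_projP.
Qed.

Definition fjoin : fsp :=
  @FSp join_car (fun q : join_car => join_proj_rep (repr (q : join_quot))).

Definition join_map_fun : fjoin -> K :=
  fun q => join_map_rep (repr (q : join_quot)).

Lemma join_map_funP q : fsp_proj (join_map_fun q) = fsp_proj q.
Proof. exact: join_map_repP. Qed.

Definition join_map : fhom fjoin K := FHom join_map_funP.

End Join.

Section Constructions.
Variables (E X : fsp) (f : fhom E X).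

Fixpoint fatwedge (n : nat) : {T : fsp & fhom T (fprodn X n)} :=
  match n return {T : fsp & fhom T (fprodn X n)} with
  | 0 => existT _ E f
  | n'.+1 =>
      let a := fhom_times_id_fhom (fprodn X n') f in
      let b := id_times_fhom_fhom X (projT2 (fatwedge n')) in
      existT _ (fjoin a b) (join_map a b)
  end.

Definition fat_wedge (n : nat) : fsp := projT1 (fatwedge n).
Definition fat_wedge_map (n : nat) : fat_wedge n -> fprodn X n :=
  projT2 (fatwedge n).

Fixpoint ganea (n : nat) : {G : fsp & fhom G X} :=
  match n with
  | 0 => existT _ E f
  | n'.+1 => existT _ (fjoin (projT2 (ganea n')) f) (join_map (projT2 (ganea n')) f)
  end.

Definition ganea_space (n : nat) : fsp := projT1 (ganea n).
Definition ganea_map (n : nat) : ganea_space n -> X := projT2 (ganea n).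

Definition fsub (U : set X) : fsp :=
  @FSp (Topological.clone (set_type U) _) (fun u => fsp_proj (val u)).

Definition fsectional (U : set X) :=
  exists s : fsub U -> E,
    fibrewise_map (s : fsub U -> E) /\
    fhtpy (fun u : fsub U => f (s u)) (fun u : fsub U => val u : X).

Definition secat_le (n : nat) :=
  exists U : 'I_n.+1 -> set X,
    (forall i, open (U i) /\ fsectional (U i)) /\ \bigcup_i U i = setT.

End Constructions.

Definition fcofibration (A X : fsp) (j : A -> X) :=
  forall (Y : fsp) (g : X -> Y) (H : (A * uI)%type -> Y),
    fibrewise_map g -> continuous H ->
    (forall a t, fsp_proj (H (a, t)) = fsp_proj a) ->
    (forall a, H (a, i0) = g (j a)) ->
    exists Ht : (X * uI)%type -> Y,
      [/\ continuous Ht,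
          (forall x t, fsp_proj (Ht (x, t)) = fsp_proj x),
          (forall x, Ht (x, i0) = g x) &
          (forall a t, Ht (j a, t) = H (a, t))].

Definition closed_fcofibration (A X : fsp) (j : A -> X) :=
  fibrewise_map j /\ fcofibration j /\ closed (range j).

End Fibrewise.

Arguments fat_wedge_map R [B E X] f n _.
Arguments ganea_map R [B E X] f n _.
Arguments fsp_proj [B] f _.

(* Main.v *)
From Pilot Require Import Defs.
From HB Require Import structures.
From mathcomp Require Import all_boot all_order all_algebra generic_quotient.
From mathcomp Require Import all_classical all_reals all_analysis.
From mathcomp Require Import lra.
Import numFieldNormedType.Exports.
Local Open Scope classical_set_scope.

Set Implicit Arguments.
Unset Strict Implicit.
Unset Printing Implicit Defensive.

(** A map [g : W -> K] lifts up to fibrewise homotopy through the join map of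
    [h : Y -> K] and [k : Z -> K] as soon as [W] is covered by two open
    sets, one on which [g] lifts through [h] and one on which it lifts
    through [k], provided a continuous function separates their
    complements; conversely, a lift to the join yields such a cover,
    because the join minus its [Z]-end deforms onto its [Y]-end and vice
    versa. Peeling off one join at a time, a lift of the identity through
    the Ganea map, or of the diagonal through the fat wedge map, gives [n
    + 1] open sets on which [f] has a homotopy section. In the other
    direction Urysohn functions on the normal space [X] glue the local
    sections; since open subspaces of [X] need not be normal, the
    induction runs over closed subsets of [X]. *)

(** * Continuity on subspaces and products, pasting, and localisation to open sets *)

Section Topology.
Import Order.TTheory GRing.Theory Num.Theory.
Local Open Scope ring_scope.

Lemma continuous_set_val (T : topologicalType) (A : set T) :
  continuous (val : set_type A -> T).
Proof. exact: initial_continuous. Qed.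

Lemma continuous_into_set_type (T S : topologicalType) (A : set S)
    (g : T -> set_type A) :
  continuous (fun x => val (g x) : S) -> continuous g.
Proof.
move=> /continuousP cg; apply/continuousP => O [P oP <-].
exact: cg _ oP.
Qed.

Definition set_incl (T : Type) (A C : set T) (AC : A `<=` C)
    (x : set_type A) : set_type C :=
  exist _ (val x) (mem_set (AC _ (set_mem (valP x)))).

Lemma continuous_set_incl (T : topologicalType) (A C : set T) (AC : A `<=` C) :
  continuous (set_incl AC).
Proof. by apply: continuous_into_set_type; exact: continuous_set_val. Qed.

Lemma continuous_pairing (T S S' : topologicalType) (g : T -> S) (h : T -> S') :
  continuous g -> continuous h -> continuous (fun x => (g x, h x)).
Proof. by move=> cg ch x; apply: cvg_pair; [exact: cg|exact: ch]. Qed.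

Lemma continuous_compose (T S U : topologicalType) (g : T -> S) (h : S -> U) :
  continuous g -> continuous h -> continuous (fun x => h (g x)).
Proof. by move=> cg ch x; apply: continuous_comp; [exact: cg|exact: ch]. Qed.

Lemma continuous_fst (T S : topologicalType) : continuous (@fst T S).
Proof. by move=> x; exact: cvg_fst. Qed.

Lemma continuous_snd (T S : topologicalType) : continuous (@snd T S).
Proof. by move=> x; exact: cvg_snd. Qed.

Lemma continuous_const (T S : topologicalType) (c : S) :
  continuous (fun _ : T => c).
Proof. by move=> x; exact: cvg_cst. Qed.

Lemma continuous_ident (T : topologicalType) : continuous (fun x : T => x).
Proof. by move=> x; exact: cvg_id. Qed.

Lemma continuous_compose2 (T S S' U : topologicalType) (F : S * S' -> U)
    (g : T -> S) (h : T -> S') :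
  continuous F -> continuous g -> continuous h ->
  continuous (fun x => F (g x, h x)).
Proof.
move=> cF cg ch; apply: (continuous_compose _ cF).
exact: continuous_pairing.
Qed.

Lemma continuous_addr (R : realType) (T : topologicalType) (g h : T -> R) :
  continuous g -> continuous h -> continuous (fun x => g x + h x).
Proof. by move=> cg ch x; apply: cvgD; [exact: cg|exact: ch]. Qed.

Lemma continuous_subr (R : realType) (T : topologicalType) (g h : T -> R) :
  continuous g -> continuous h -> continuous (fun x => g x - h x).
Proof. by move=> cg ch x; apply: cvgB; [exact: cg|exact: ch]. Qed.

Lemma continuous_mulr (R : realType) (T : topologicalType) (g h : T -> R) :
  continuous g -> continuous h -> continuous (fun x => g x * h x).
Proof. by move=> cg ch x; apply: cvgM; [exact: cg|exact: ch]. Qed.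

(** Off the locus [c x = a] a single branch governs a whole neighbourhood. On it both branches take
    the same value, and the neighbourhoods that they provide are intersected. *)
Lemma continuous_if_le (R : realType) (T S : topologicalType) (c : T -> R)
    (a : R) (g h : T -> S) :
  continuous c -> continuous g -> continuous h ->
  (forall x, c x = a -> g x = h x) ->
  continuous (fun x => if c x <= a then g x else h x).
Proof.
move=> cc cg ch gh x O /=.
have [cxa|cxa|cxa] := ltgtP (c x) a => nO.
- have cya : \forall y \near x, c y < a by exact: cvgr_lt (cc x) _ cxa.
  have gy := cg x O nO.
  by move: cya gy; apply: filterS2 => y /= cya; rewrite (ltW cya).
- have cya : \forall y \near x, a < c y by exact: cvgr_gt (cc x) _ cxa.
  have hy := ch x O nO.
  by move: cya hy; apply: filterS2 => y /= cya; rewrite leNgt cya.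
- have hy : nbhs x (h @^-1` O) by apply: (ch x); rewrite -gh.
  have gy : nbhs x (g @^-1` O) by exact: (cg x).
  by move: gy hy; apply: filterS2 => y /= gy hy; case: ifP.
Qed.

(** The hypothesis says that [a] is open at [s], so a neighbourhood found upstairs can be pushed
    forward. With [a] the inclusion of an open set this localises continuity. *)
Lemma continuous_at_descent (S T U : topologicalType) (a : S -> T) (s : S)
    (F : T -> U) :
  (forall A, nbhs s A -> nbhs (a s) (a @` A)) ->
  {for s, continuous (fun x => F (a x))} -> {for a s, continuous F}.
Proof.
move=> oa cF O nO; have := oa _ (cF O nO).
by apply: filterS => _ [y Oy <-].
Qed.

Lemma open_set_val_image (T : topologicalType) (O : set T) (s : set_type O)
    (A : set (set_type O)) :
  open O -> nbhs s A -> nbhs (val s) (val @` A).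
Proof.
move=> oO nA; rewrite nbhsE in nA; case: nA => _ [[P oP <-] Ps sub].
have : nbhs (val s) (O `&` P).
  apply: open_nbhs_nbhs; split; first exact: openI.
  by split=> //; exact: set_mem (valP s).
apply: filterS => y [Oy Py]; exists (exist _ y (mem_set Oy)) => //.
exact: sub.
Qed.

Lemma continuous_at_open (T U : topologicalType) (O : set T) (F : T -> U) x :
  open O -> O x -> continuous (fun y : set_type O => F (val y)) ->
  {for x, continuous F}.
Proof.
move=> oO Ox cF.
apply: (@continuous_at_descent _ _ _ (val : set_type O -> T)
  (exist _ x (mem_set Ox))) => [A|]; first exact: open_set_val_image.
exact: cF.
Qed.

(** The time coordinate of a homotopy is carried along: [val] times the identity sends boxes to
    boxes, hence is open at each point. *)
Lemma continuous_at_open_prod (T S U : topologicalType) (O : set T)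
    (F : T * S -> U) p :
  open O -> O p.1 ->
  continuous (fun y : set_type O * S => F (val y.1, y.2)) ->
  {for p, continuous F}.
Proof.
case: p => x s /= oO Ox cF.
apply: (@continuous_at_descent _ _ _ (fun y : set_type O * S => (val y.1, y.2))
  (exist _ x (mem_set Ox), s)) => [A|]; last exact: cF.
move=> [[P Q] /= [nP nQ] PQ].
exists (val @` P, Q) => /=.
  by split=> //; exact: (@open_set_val_image _ _ (exist _ x (mem_set Ox))).
by move=> [_ z] /= [[y Py <-] Qz]; exists (y, z) => //; exact: PQ.
Qed.

(** * The unit interval and its function spaces *)

Variable R : realType.
Local Notation I := (uI R).

Lemma clamp_subproof (r : R) :
  Num.max 0 (Num.min 1 r) \in (`[0, 1]%classic : set R).
Proof.
apply: mem_set; rewrite /= in_itv /= le_max lexx /= ge_max ler01 /=.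
by rewrite ge_min lexx.
Qed.

(** Truncation makes every real formula a point of the interval, so reparametrisations need no proof
    of range, and values beyond an end are sent to that end. *)
Definition clamp (r : R) : I :=
  exist _ (Num.max 0 (Num.min 1 r)) (clamp_subproof r).

Lemma val_clamp r : 0 <= r <= 1 -> val (clamp r) = r.
Proof. by move=> /andP[r0 r1] /=; rewrite min_r// max_r. Qed.

Lemma uI_itv (t : I) : 0 <= val t <= 1.
Proof. by have := set_mem (valP t); rewrite /= in_itv. Qed.

Lemma clamp_val (t : I) : clamp (val t) = t.
Proof. by apply: val_inj; rewrite val_clamp// uI_itv. Qed.

Lemma clamp_le0 r : r <= 0 -> clamp r = i0 R.
Proof.
move=> r0; apply: val_inj => /=.
by rewrite min_r ?max_l// (le_trans r0).
Qed.

Lemma clamp_ge1 r : 1 <= r -> clamp r = i1 R.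
Proof. by move=> r1; apply: val_inj => /=; rewrite min_l// max_r. Qed.

Lemma continuous_clamp : continuous clamp.
Proof.
apply: continuous_into_set_type => /= x.
apply: continuous_max; first exact: cvg_cst.
by apply: continuous_min; [exact: cvg_cst|exact: cvg_id].
Qed.

Lemma continuous_uI_val : continuous (val : I -> R).
Proof. exact: continuous_set_val. Qed.

Lemma compact_uI : compact [set: I].
Proof.
have -> : [set: I] = clamp @` `[0, 1].
  apply/seteqP; split=> // t _; exists (val t); last exact: clamp_val.
  by rewrite /= in_itv /= uI_itv.
apply: continuous_compact; last exact: segment_compact.
exact/continuous_subspaceT/continuous_clamp.
Qed.

Lemma hausdorff_uI : hausdorff_space I.
Proof.
rewrite open_hausdorff => x y xy.
have : hausdorff_space R by exact: Rhausdorff.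
rewrite open_hausdorff => /(_ (val x) (val y)).
case=> [|[P Q] /= [Px Qy] [oP oQ PQ0]].
  by apply: contra_neq xy => /val_inj.
exists (val @^-1` P, val @^-1` Q) => /=.
  by split; apply/mem_set; [exact: set_mem Px|exact: set_mem Qy].
split; [by exists P|by exists Q|].
by rewrite -preimage_setI (eqP PQ0) preimage_set0.
Qed.

Lemma locally_compact_uI : locally_compact [set: I].
Proof.
move=> t _; exists setT; first by rewrite withinET; exact: filterT.
by split; [exact: compact_uI|exact: closedT].
Qed.

(** Uncurrying is legitimate because the interval is locally compact and Hausdorff. It turns
    continuity into a path space into joint continuity in point and time. *)
Lemma continuous_uncurry_uI (T S : topologicalType)
    (F : T -> {compact-open, I -> S}) :
  continuous F -> (forall x, continuous (F x)) ->
  continuous (fun p : T * I => F p.1 p.2).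
Proof.
move=> cF cFx.
have -> : (fun p : T * I => F p.1 p.2) = uncurry F by apply/funext => -[].
by apply: continuous_uncurry => //;
  [exact: locally_compact_uI|exact: hausdorff_uI].
Qed.

Lemma continuous_curry_uI (T S : topologicalType) (F : T * I -> S) :
  continuous F ->
  continuous ((fun x t => F (x, t)) : T -> {compact-open, I -> S}).
Proof. by move/continuous_curry_fun. Qed.

End Topology.

(** * Lifts up to fibrewise homotopy *)

Section Lifting.
Import Order.TTheory GRing.Theory Num.Theory.
Local Open Scope ring_scope.
Variables (R : realType) (B : topologicalType).
Local Notation I := (uI R).

(** All three conditions of the theorem are instances: a sectional open set is one whose inclusion
    lifts through [f], and (ii) and (iii) ask for lifts of the diagonal through [fat_wedge_map] and
    of the identity through [ganea_map]. *)
Definition flift (W Y K : fsp B) (h : Y -> K) (g : W -> K) :=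
  exists s : W -> Y, fibrewise_map s /\ fhtpy R (fun x => h (s x)) g.

Lemma fibrewise_map_comp (X Y Z : fsp B) (g : X -> Y) (h : Y -> Z) :
  fibrewise_map g -> fibrewise_map h -> fibrewise_map (fun x => h (g x)).
Proof.
move=> [cg pg] [ch ph]; split; first exact: continuous_compose.
by move=> x; rewrite ph pg.
Qed.

Lemma fibrewise_map_id (X : fsp B) : fibrewise_map (fun x : X => x).
Proof. by split=> // x; exact: cvg_id. Qed.

Lemma fibrewise_map_val (X : fsp B) (U : set X) :
  fibrewise_map (fun u : fsub U => val u : X).
Proof. by split=> //; exact: continuous_set_val. Qed.

Lemma fhtpy_trans (X Y : fsp B) (g0 g1 g2 : X -> Y) :
  fhtpy R g0 g1 -> fhtpy R g1 g2 -> fhtpy R g0 g2.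
Proof.
move=> [H [cH pH H0 H1]] [H' [cH' pH' H'0 H'1]].
have cv : continuous (fun p : X * I => val p.2 : R).
  by apply: continuous_compose; [exact: continuous_snd|exact: continuous_uI_val].
exists (fun p => if val p.2 <= 1 / 2 then H (p.1, clamp (2 * val p.2))
                 else H' (p.1, clamp (2 * val p.2 - 1))); split.
- apply: continuous_if_le => //.
  + apply: (continuous_compose2 cH).
      exact: continuous_fst.
    apply: continuous_compose (@continuous_clamp R).
    exact: continuous_mulr (@continuous_const _ _ _) cv.
  + apply: continuous_compose cH'; apply: continuous_pairing.
      exact: continuous_fst.
    apply: continuous_compose (@continuous_clamp R).
    apply: continuous_subr (@continuous_const _ _ _).
    exact: continuous_mulr (@continuous_const _ _ _) cv.
  + move=> p ->; rewrite clamp_ge1; last lra.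
    by rewrite clamp_le0 ?H1 ?H'0//; lra.
- by move=> x t; case: ifP; rewrite ?pH ?pH'.
- by move=> x; rewrite ifT /=; [rewrite clamp_le0 ?H0//; lra|lra].
- move=> x; rewrite ifF /=; first by rewrite clamp_ge1 ?H'1//; lra.
  by apply/negbTE; rewrite -ltNge; lra.
Qed.

Lemma fhtpy_comp (W X Y Z : fsp B) (a : W -> X) (g0 g1 : X -> Y) (c : Y -> Z) :
  fibrewise_map a -> fibrewise_map c -> fhtpy R g0 g1 ->
  fhtpy R (fun w => c (g0 (a w))) (fun w => c (g1 (a w))).
Proof.
move=> [ca pa] [cc pc] [H [cH pH H0 H1]].
exists (fun p => c (H (a p.1, p.2))); split.
- apply: continuous_compose cc; apply: continuous_compose cH.
  apply: continuous_pairing; last exact: continuous_snd.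
  exact: continuous_compose (@continuous_fst _ _) ca.
- by move=> x t; rewrite pc pH pa.
- by move=> x; rewrite H0.
- by move=> x; rewrite H1.
Qed.

Lemma flift_comp (W V Y K : fsp B) (h : Y -> K) (g : W -> K) (a : V -> W) :
  fibrewise_map a -> flift h g -> flift h (fun v => g (a v)).
Proof.
move=> fa [s [fs Hs]]; exists (fun v => s (a v)).
split; first exact: fibrewise_map_comp.
exact: (fhtpy_comp fa (@fibrewise_map_id K) Hs).
Qed.

(** A commutative square from [h] to [k] carries a lift and its homotopy along; this is how one
    coordinate is extracted from a lift into a fibrewise product. *)
Lemma flift_map (W Y Z K L : fsp B) (h : Y -> K) (k : Z -> L) (g : W -> K)
    (c : K -> L) (d : Y -> Z) :
  fibrewise_map c -> fibrewise_map d -> (forall y, k (d y) = c (h y)) ->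
  flift h g -> flift k (fun w => c (g w)).
Proof.
move=> fc fd kd [s [fs Hs]]; exists (fun w => d (s w)).
split; first exact: fibrewise_map_comp.
have -> : (fun w => k (d (s w))) = (fun w => c (h (s w))) by apply/funext.
exact: (fhtpy_comp (@fibrewise_map_id W) fc Hs).
Qed.

(** A cover found by induction lives on a subspace, while its members must become subsets of [W].
    Choosing the preimage point in [V] is continuous, since the subspace topologies only see its
    value in [W]. *)
Lemma flift_sub_sub (W Y K : fsp B) (h : Y -> K) (g : W -> K) (U : set W)
    (V : set (fsub U)) :
  flift h (fun v : fsub V => g (val (val v))) ->
  flift h (fun v : fsub (val @` V : set W) => g (val v)).
Proof.
move=> [s [[cs ps] [H [cH pH H0 H1]]]].
have aP (v : fsub (val @` V : set W)) : {x : fsub V | val (val x) = val v}.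
  apply: cid; case: (set_mem (valP v)) => u Vu <-.
  by exists (exist _ u (mem_set Vu)).
pose a v := sval (aP v).
have aE v : val (val (a v)) = val v := svalP (aP v).
have fa : fibrewise_map (a : fsub (val @` V : set W) -> fsub V).
  split; last by move=> v; rewrite /fsp_proj/= aE.
  do 2 apply: continuous_into_set_type.
  have -> : (fun x => val (val (a x)) : W) = (fun x => val x).
    by apply/funext => x; exact: aE.
  exact: continuous_set_val.
have : flift h (fun v => g (val (val (a v)))).
  apply: (@flift_comp _ _ _ _ h (fun v : fsub V => g (val (val v)))) => //.
  by exists s; split=> //; exists H.
by congr (flift h _); apply/funext => v; rewrite aE.
Qed.

End Lifting.

(** * The quotient topology of the join and continuity of the join map *)

Section JoinTopology.
Import Order.TTheory GRing.Theory Num.Theory.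
Local Open Scope ring_scope.
Local Open Scope quotient_scope.
Variables (R : realType) (B : topologicalType).
Variables (Y Z K : fsp B) (h : fhom Y K) (k : fhom Z K).
Local Notation I := (uI R).
Local Notation S := (join_sum R h k).
Local Notation J := (fjoin R h k).

Definition jpi (x : S) : J := \pi_(join_quot R h k) x.

(** [join_rep] is constant on equivalence classes, so a quantity that it preserves may be computed
    at [repr] or at any other representative. *)
Lemma join_rep_repr (x : S) :
  join_rep (repr (jpi x : join_quot R h k)) = join_rep x.
Proof. by have /eqmodP/eqP := reprK (jpi x : join_quot R h k). Qed.

Lemma jpi_eq (x y : S) : join_rep x = join_rep y -> jpi x = jpi y.
Proof. by move=> xy; apply/eqmodP/eqP. Qed.

Lemma continuous_jpi : continuous jpi.
Proof. exact: (@pi_continuous S (join_quot R h k)). Qed.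

Lemma uI_eq0 (t : I) : val t = 0 -> t = i0 R.
Proof. by move=> t0; apply: val_inj. Qed.

Lemma uI_eq1 (t : I) : val t = 1 -> t = i1 R.
Proof. by move=> t1; apply: val_inj. Qed.

Lemma Ehk_theta0 (e : Ehk R h k) : Ehk_theta e (i0 R) = h (Ehk_y e).
Proof. by have [-> _] := set_mem (valP e). Qed.

Lemma Ehk_theta1 (e : Ehk R h k) : Ehk_theta e (i1 R) = k (Ehk_z e).
Proof. by have [_ ->] := set_mem (valP e). Qed.

Lemma join_map_rep_rep (x : S) : join_map_rep (join_rep x) = join_map_rep x.
Proof.
case: x => -[[]|] //= [e t] /=.
case: eqP => [t0|_]; first by rewrite (uI_eq0 t0) Ehk_theta0.
by case: eqP => [t1|//]; rewrite (uI_eq1 t1) Ehk_theta1.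
Qed.

Lemma join_mapE (x : S) : join_map R h k (jpi x) = join_map_rep x.
Proof. by rewrite -join_map_rep_rep -join_rep_repr join_map_rep_rep. Qed.

Lemma fsp_proj_jpi (x : S) : fsp_proj J (jpi x) = join_proj_rep x.
Proof. by rewrite -(fhom_projP (join_map R h k)) join_mapE join_map_repP. Qed.

Lemma jpi_left (e : Ehk R h k) :
  jpi (existT _ None (e, i0 R)) = jpi (existT _ (Some true) (Ehk_y e)).
Proof. by apply: jpi_eq; rewrite /= eqxx. Qed.

Lemma jpi_right (e : Ehk R h k) :
  jpi (existT _ None (e, i1 R)) = jpi (existT _ (Some false) (Ehk_z e)).
Proof. by apply: jpi_eq; rewrite /= oner_eq0 eqxx. Qed.

(** Invariance under [join_rep] makes [A] saturated: the set in the join pulls back to [A] itself,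
    and the quotient topology asks only for openness of the pullback. *)
Lemma open_jpi (A : set S) : open A -> (forall x, A (join_rep x) <-> A x) ->
  open [set q : J | A (repr (q : join_quot R h k))].
Proof.
move=> oA Arep; rewrite /open /= /quotient_open.
suff -> : \pi_(join_quot R h k) @^-1`
  [set q : J | A (repr (q : join_quot R h k))] = A by [].
apply/seteqP; split=> x /=; rewrite -[repr _]/(repr (jpi x : join_quot R h k)).
  by move=> /Arep; rewrite join_rep_repr => /Arep.
by move=> /Arep; rewrite -join_rep_repr => /Arep.
Qed.

Lemma continuous_Ehk_y : continuous (@Ehk_y R B Y Z K h k).
Proof.
exact: (continuous_compose (@continuous_set_val _ (@Ehk_set R B Y Z K h k))
  (@continuous_fst _ _)).
Qed.

Lemma continuous_Ehk_path :
  continuous (fun e : Ehk R h k => (val e).2.1 : pathB R K).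
Proof.
exact: (continuous_compose (continuous_compose
  (@continuous_set_val _ (@Ehk_set R B Y Z K h k)) (@continuous_snd _ _))
  (@continuous_fst _ _)).
Qed.

Lemma continuous_Ehk_z : continuous (@Ehk_z R B Y Z K h k).
Proof.
exact: (continuous_compose (continuous_compose
  (@continuous_set_val _ (@Ehk_set R B Y Z K h k)) (@continuous_snd _ _))
  (@continuous_snd _ _)).
Qed.

Lemma continuous_Ehk_theta_at (e : Ehk R h k) : continuous (Ehk_theta e).
Proof. by have [] := set_mem (valP (val e).2.1). Qed.

Lemma continuous_Ehk_theta :
  continuous (fun p : Ehk R h k * I => Ehk_theta p.1 p.2).
Proof.
apply: (@continuous_uncurry_uI R _ _
  (@Ehk_theta R B Y Z K h k : Ehk R h k -> {compact-open, I -> K})).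
  exact: (continuous_compose (continuous_compose continuous_Ehk_path
    (@continuous_set_val _ (@pathB_set R B K))) (@continuous_snd _ _)).
exact: continuous_Ehk_theta_at.
Qed.

Hypotheses (ch : continuous h) (ck : continuous k).

Lemma continuous_join_map : continuous (join_map R h k).
Proof.
apply/(@quotient_continuous S (join_quot R h k)).
have -> : join_map R h k \o \pi_(join_quot R h k) = @join_map_rep R B Y Z K h k.
  by apply/funext => x; exact: join_mapE.
apply/continuousP => O oO; apply/sigT_openP => -[[]|].
- by move/continuousP : ch; exact.
- by move/continuousP : ck; exact.
- by move/continuousP : continuous_Ehk_theta; exact.
Qed.

(** * Deformation of the join minus one end onto the other end *)

Definition endpt (b : bool) : R := if b then 0 else 1.

Definition Ehk_end (b : bool) : Ehk R h k -> join_piece R h k (Some b) :=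
  if b return Ehk R h k -> join_piece R h k (Some b)
  then @Ehk_y R B Y Z K h k else @Ehk_z R B Y Z K h k.

(** Both ends are read off [join_piece], so one argument with a boolean parameter treats [Y] and [Z]
    together. *)
Definition jend_fsp (b : bool) : fsp B :=
  @FSp B (join_piece R h k (Some b))
    (fun y => join_proj_rep (existT (join_piece R h k) (Some b) y)).

Definition jend (b : bool) : jend_fsp b -> K :=
  fun y => join_map_rep (existT (join_piece R h k) (Some b) y).

(* The image of a point under the retraction of the join minus one end onto the
   other end [b], where [true] is the [Y]-end; [shadow_path] is the track of the
   corresponding deformation, read in [K]. *)
Definition shadow (b : bool) (x : S) : option (jend_fsp b) :=
  match x with
  | existT o m =>
    match o return join_piece R h k o -> option (jend_fsp b) with
    | None => fun m =>
        if val m.2 == endpt (~~ b) then None else Some (Ehk_end b m.1)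
    | Some c =>
        match b, c return join_piece R h k (Some c) -> option (jend_fsp b) with
        | true, true => fun y => Some y
        | false, false => fun z => Some z
        | _, _ => fun=> None
        end
    end m
  end.

Definition shadow_path (b : bool) (x : S) : {compact-open, I -> K} :=
  match x with
  | existT o m =>
    match o return join_piece R h k o -> I -> K with
    | None => fun m u =>
        Ehk_theta m.1 (clamp (endpt b + val u * (val m.2 - endpt b)))
    | Some c => fun m _ => join_map_rep (existT (join_piece R h k) (Some c) m)
    end m
  end.

(** A cylinder point at parameter [0] or [1] is glued to an end; either its shadow is that same end
    point or both shadows are undefined. Hence [shadow] descends to the join. *)
Lemma shadow_rep b x : shadow b (join_rep x) = shadow b x.
Proof.
case: x => -[[]|] //= [e t] /=.
have [t0|_] := eqVneq (val t) 0.
  by rewrite t0; case: b; rewrite /= ?eqxx// eq_sym oner_eq0.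
have [t1|t1] := eqVneq (val t) 1.
  by rewrite t1; case: b; rewrite /= ?eqxx// oner_eq0.
by [].
Qed.

(** The proviso excludes the opposite end: there the track of a cylinder point is the whole of
    [Ehk_theta], whereas an end point carries a constant path. *)
Lemma shadow_path_rep b x : shadow b x <> None ->
  shadow_path b (join_rep x) = shadow_path b x.
Proof.
case: x => -[[]|] //= [e t] /=.
have [t0|_] := eqVneq (val t) 0.
  rewrite t0; case: b; rewrite /= ?eqxx// => _; apply/funext => u.
  by rewrite clamp_le0 ?Ehk_theta0//; lra.
have [t1|//] := eqVneq (val t) 1.
rewrite t1; case: b; rewrite /= ?eqxx// => _; apply/funext => u.
by rewrite clamp_ge1 ?Ehk_theta1//; lra.
Qed.

Lemma continuous_shadow_path_at b x : continuous (shadow_path b x).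
Proof.
case: x => -[c|] m /=; first exact: continuous_const.
apply: (@continuous_compose _ _ _
  (fun u : I => clamp (endpt b + val u * (val m.2 - endpt b)))
  (Ehk_theta m.1)); last exact: continuous_Ehk_theta_at.
apply: continuous_compose (@continuous_clamp R).
apply: continuous_addr; first exact: continuous_const.
apply: continuous_mulr; [exact: continuous_uI_val|exact: continuous_const].
Qed.

Lemma shadow_path0 b x y : shadow b x = Some y ->
  shadow_path b x (i0 R) = jend y.
Proof.
case: x => -[c|] m /=; first by case: b y; case: c m => // m y [->].
rewrite mul0r addr0 /jend; case: b y => y /=; case: ifP => // _ [<-].
  by rewrite clamp_le0 ?Ehk_theta0.
by rewrite clamp_ge1 ?Ehk_theta1.
Qed.

Lemma shadow_path1 b x : shadow_path b x (i1 R) = join_map_rep x.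
Proof.
case: x => -[c|] m //=; congr (Ehk_theta _ _).
by rewrite mul1r addrC subrK clamp_val.
Qed.

Lemma shadow_path_proj b x u :
  fsp_proj K (shadow_path b x u) = join_proj_rep x.
Proof.
by case: x => -[[]|] m /=; rewrite ?fhom_projP//; exact: pathB_projP.
Qed.

Lemma shadow_proj b x y : shadow b x = Some y ->
  fsp_proj (jend_fsp b) y = join_proj_rep x.
Proof.
move=> xy; rewrite -(shadow_path_proj b x (i0 R)) (shadow_path0 xy).
by rewrite join_map_repP.
Qed.

(** This gives at once an open domain, by taking [O] full, and continuity of the partial map
    [shadow]. The three summands contribute [O] at the end [b], nothing at the other end, and on the
    cylinder an open condition on the parameter together with the preimage of [O] under
    [Ehk_end]. *)
Lemma open_shadow b (O : set (jend_fsp b)) : open O ->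
  open [set x | exists2 y, O y & shadow b x = Some y].
Proof.
move=> oO; apply/sigT_openP => -[c|].
  case: (eqVneq b c) O oO => [<-|bc] O oO.
    suff -> : existT (join_piece R h k) (Some b) @^-1`
      [set x | exists2 y, O y & shadow b x = Some y] = O by [].
    by apply/seteqP; split=> y /=; case: b O y {oO} => O y;
      [case=> z Oz [->]|case=> z Oz [->]|exists y|exists y].
  suff -> : existT (join_piece R h k) (Some c) @^-1`
    [set x | exists2 y, O y & shadow b x = Some y] = set0 by exact: open0.
  by apply/seteqP; split=> y //=; case: b c bc O y {oO} => -[] // _ O y [].
have -> : existT (join_piece R h k) None @^-1`
    [set x | exists2 y, O y & shadow b x = Some y] =
  [set m : Ehk R h k * I | val m.2 != endpt (~~ b)] `&`
  [set m | O (Ehk_end b m.1)].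
  apply/seteqP; split=> m /=.
    by case: (b) (O) => P [y Py]; case: ifP => //= _ [->].
  by move=> [/negbTE -> Om]; exists (Ehk_end b m.1).
apply: openI.
  have cv : continuous (fun m : Ehk R h k * I => val m.2 : R).
    apply: continuous_compose (@continuous_uI_val R); exact: continuous_snd.
  move/continuousP : cv => /(_ [set r | r != endpt (~~ b)]); apply.
  exact: open_neq.
have ce : continuous (fun m : Ehk R h k * I => Ehk_end b m.1).
  apply: (@continuous_compose _ _ _ fst (Ehk_end b)).
    exact: continuous_fst.
  by case: (b); [exact: continuous_Ehk_y|exact: continuous_Ehk_z].
by move/continuousP : ce; exact.
Qed.

Lemma continuous_jend b : continuous (@jend b).
Proof. by case: b. Qed.

(** On each summand the path depends jointly continuously on point and time, and currying moves this
    to the compact-open topology. The domain condition is part of the set because it is there that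
    [shadow_path] respects the gluing. *)
Lemma open_shadow_path b (O : set {compact-open, I -> K}) : open O ->
  open [set x | shadow b x <> None /\ O (shadow_path b x)].
Proof.
move=> oO.
have -> : [set x | shadow b x <> None /\ O (shadow_path b x)] =
    [set x | exists2 y, [set: jend_fsp b] y & shadow b x = Some y] `&`
    [set x | O (shadow_path b x)].
  apply/seteqP; split=> x /= [sx Ox]; split=> //.
    by case: (shadow b x) sx => // y _; exists y.
  by case: sx => y _ ->.
apply: openI; first exact/open_shadow/openT.
apply/sigT_openP => -[c|].
  have cc : continuous ((fun m _ => @jend c m) :
      jend_fsp c -> {compact-open, I -> K}).
    apply: (@continuous_curry_uI R _ _ (fun p : jend_fsp c * I => @jend c p.1)).
    apply: continuous_compose (@continuous_jend c); exact: continuous_fst.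
  by move/continuousP : cc; exact.
have cc : continuous ((fun m u =>
    Ehk_theta m.1 (clamp (endpt b + val u * (val m.2 - endpt b)))) :
    Ehk R h k * I -> {compact-open, I -> K}).
  apply: (@continuous_curry_uI R _ _ (fun p : (Ehk R h k * I) * I =>
    Ehk_theta p.1.1 (clamp (endpt b + val p.2 * (val p.1.2 - endpt b))))).
  apply: (@continuous_compose _ _ _ (fun p : (Ehk R h k * I) * I =>
    (p.1.1, clamp (endpt b + val p.2 * (val p.1.2 - endpt b)))) _ _
    continuous_Ehk_theta).
  apply: continuous_pairing.
    by apply: continuous_compose (@continuous_fst _ _); exact: continuous_fst.
  apply: continuous_compose (@continuous_clamp R).
  apply: continuous_addr; first exact: continuous_const.
  apply: continuous_mulr.
    exact: (continuous_compose (@continuous_snd _ _) (@continuous_uI_val R)).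
  apply: continuous_subr; last exact: continuous_const.
  exact: (continuous_compose
    (continuous_compose (@continuous_fst _ _) (@continuous_snd _ _))
    (@continuous_uI_val R)).
by move/continuousP : cc; exact.
Qed.

Lemma shadow_cover x : shadow true x <> None \/ shadow false x <> None.
Proof.
case: x => -[[]|] m /=; [by left|by right|].
have [m1|m1] := eqVneq (val m.2) 1; last by left.
by right; rewrite m1 oner_eq0.
Qed.

Lemma open_shadow_jpi b (O : set (jend_fsp b)) : open O ->
  open [set q : J | exists2 y, O y &
    shadow b (repr (q : join_quot R h k)) = Some y].
Proof.
move=> oO.
apply: (@open_jpi [set x | exists2 y, O y & shadow b x = Some y]).
  exact: open_shadow.
by move=> x; rewrite /= shadow_rep.
Qed.

Lemma open_shadow_path_jpi b (O : set {compact-open, I -> K}) : open O ->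
  open [set q : J | shadow b (repr (q : join_quot R h k)) <> None /\
    O (shadow_path b (repr (q : join_quot R h k)))].
Proof.
move=> oO.
apply: (@open_jpi [set x | shadow b x <> None /\ O (shadow_path b x)]).
  exact: open_shadow_path.
move=> x /=; rewrite shadow_rep; split=> -[sx]; by rewrite shadow_path_rep.
Qed.

(** [U b] is where the lift avoids the end opposite to [b]. There the shadow of the lift is a map to
    the end [b], and its track in [K] followed by the given homotopy connects it to [g]. *)
Lemma flift_join_split (W : fsp B) (g : W -> K) :
  flift R (join_map R h k) g ->
  exists U : bool -> set W,
    [/\ forall b, open (U b), forall w, U true w \/ U false w &
        forall b, flift R (@jend b) (fun w : fsub (U b) => g (val w))].
Proof.
move=> [phi [[cphi pphi] Hphi]].
pose rphi w := repr (phi w : join_quot R h k).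
exists (fun b => [set w | shadow b (rphi w) <> None]); split.
- move=> b; move/continuousP : cphi.
  move=> /(_ _ (open_shadow_jpi (@openT (jend_fsp b)))).
  congr open; apply/seteqP; split=> w /=.
    by case=> y _; rewrite /rphi => ->.
  by rewrite /rphi; case: shadow => // y _; exists y.
- by move=> w; exact: shadow_cover.
- move=> b; set U := [set w | _].
  have sP (w : fsub U) : {y | shadow b (rphi (val w)) = Some y}.
    have := set_mem (valP w); rewrite /U /=.
    by case: shadow => // y _; exists y.
  pose s w := sval (sP w).
  have sE w : shadow b (rphi (val w)) = Some (s w) := svalP (sP w).
  have cphiv : continuous (fun w : fsub U => phi (val w)).
    exact: (continuous_compose (@continuous_set_val _ U) cphi).
  have {}cphiv A : open A -> open [set w : fsub U | A (phi (val w))].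
    by move/continuousP : cphiv; exact.
  exists s; split.
    split; last by move=> w; exact: etrans (shadow_proj (sE w)) (pphi (val w)).
    apply/continuousP => O oO; have := cphiv _ (open_shadow_jpi oO).
    congr open; apply/seteqP; split=> w /=.
      by case=> y Oy; rewrite -/(rphi _) sE => -[->].
    by move=> Ow; exists (s w) => //; exact: sE.
  apply: fhtpy_trans (fhtpy_comp (@fibrewise_map_val _ _ U)
    (@fibrewise_map_id _ K) Hphi).
  exists (fun p => shadow_path b (rphi (val p.1)) p.2); split.
  + apply: (@continuous_uncurry_uI R _ _
      (fun w : fsub U => shadow_path b (rphi (val w)))).
      apply/continuousP => O oO; have := cphiv _ (@open_shadow_path_jpi b _ oO).
      congr open; apply/seteqP; split=> w /=; first by case.
      by split=> //; rewrite -/(rphi _) sE.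
    by move=> w; exact: continuous_shadow_path_at.
  + by move=> w t; rewrite shadow_path_proj; exact: pphi (val w).
  + by move=> w; rewrite (shadow_path0 (sE w)).
  + by move=> w; rewrite shadow_path1.
Qed.

End JoinTopology.

(** * Gluing two local lifts into a lift through the join *)

Section JoinGluing.
Import Order.TTheory GRing.Theory Num.Theory.
Local Open Scope ring_scope.
Variables (R : realType) (B : topologicalType).
Variables (Y Z K : fsp B) (h : fhom Y K) (k : fhom Z K).
Local Notation I := (uI R).

(* On [0 < lam < 1] the two homotopies are concatenated to a path [th] from
   [h s] through [g] to [k r]; the map to the join uses [th] at time
   [clamp (3 lam - 1)], which is locally constant near both ends, and sliding
   that time to [1 / 2] gives the homotopy to [g]. *)
Lemma flift_join_glue (W : fsp B) (g : W -> K) (lam : W -> R) :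
  continuous (fsp_proj W) -> continuous lam ->
  flift R h (fun w : fsub [set w | lam w < 1] => g (val w)) ->
  flift R k (fun w : fsub [set w | 0 < lam w] => g (val w)) ->
  flift R (join_map R h k) g.
Proof.
set U := [set w | lam w < 1]; set V := [set w | 0 < lam w].
move=> cW clam [s [[cs ps] [Hs [cHs pHs Hs0 Hs1]]]].
move=> [r [[cr pr] [Hr [cHr pHr Hr0 Hr1]]]].
pose UV := U `&` V.
pose uU : set_type UV -> fsub U := set_incl (@subIsetl _ U V).
pose uV : set_type UV -> fsub V := set_incl (@subIsetr _ U V).
have cuU : continuous uU by exact: continuous_set_incl.
have cuV : continuous uV by exact: continuous_set_incl.
have cv (T : topologicalType) : continuous (fun p : T * I => val p.2 : R).
  exact: (continuous_compose (@continuous_snd _ _) (@continuous_uI_val R)).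
(* The second half traverses [Hr] backwards, so the two halves meet in the value of [g] at time
   [1 / 2]. *)
pose th (p : set_type UV * I) : K :=
  if val p.2 <= 1 / 2 then Hs (uU p.1, clamp (2 * val p.2))
  else Hr (uV p.1, clamp (2 - 2 * val p.2)).
have thL w t : val t <= 1 / 2 -> th (w, t) = Hs (uU w, clamp (2 * val t)).
  by rewrite /th /= => ->.
have thR w t : 1 / 2 <= val t -> th (w, t) = Hr (uV w, clamp (2 - 2 * val t)).
  rewrite le_eqVlt => /predU1P[t2|t2]; last by rewrite /th /= leNgt t2.
  rewrite thL -?t2//; rewrite clamp_ge1 ?Hs1; last lra.
  by rewrite clamp_ge1 ?Hr1//; lra.
have cth : continuous th.
  apply: continuous_if_le; first exact: cv.
  - apply: (continuous_compose2 cHs).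
      exact: (continuous_compose (@continuous_fst _ _) cuU).
    apply: continuous_compose (@continuous_clamp R).
    apply: continuous_mulr; [exact: continuous_const|exact: cv].
  - apply: (continuous_compose2 cHr).
      exact: (continuous_compose (@continuous_fst _ _) cuV).
    apply: continuous_compose (@continuous_clamp R).
    apply: continuous_subr; first exact: continuous_const.
    apply: continuous_mulr; [exact: continuous_const|exact: cv].
  - move=> [w t] t2; have {}t2 : val t = 1 / 2 := t2.
    by apply: etrans (esym (thL w t _)) (thR w t _); rewrite t2.
have pth w t : fsp_proj K (th (w, t)) = fsp_proj W (val w).
  by rewrite /th; case: ifP; rewrite ?pHs ?pHr.
have th0 w : th (w, i0 R) = h (s (uU w)).
  rewrite thL /=; last lra.
  by rewrite clamp_le0 ?Hs0//; lra.
have th1 w : th (w, i1 R) = k (r (uV w)).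
  rewrite thR /=; last lra.
  by rewrite clamp_le0 ?Hr0//; lra.
pose co (w : set_type UV) : {compact-open, I -> K} := fun t => th (w, t).
have cco : continuous co by exact: continuous_curry_uI.
have co_path (w : set_type UV) : pathB_set (fsp_proj W (val w), co w).
  split=> /= [|t]; last exact: pth.
  apply: (continuous_compose _ cth).
  apply: continuous_pairing; [exact: continuous_const|exact: continuous_ident].
pose path (w : set_type UV) : pathB R K :=
  exist _ (fsp_proj W (val w), co w) (mem_set (co_path w)).
(* A point of [pathB] records its base point, which varies continuously because the projection of
   [W] does. *)
have cpath : continuous path.
  apply: continuous_into_set_type; apply: continuous_pairing => //.
  exact: (continuous_compose (@continuous_set_val _ UV) cW).
have e_in (w : set_type UV) :
    @Ehk_set R B Y Z K h k (s (uU w), (path w, r (uV w))).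
  by split; rewrite /= /co ?th0 ?th1.
pose e (w : set_type UV) : Ehk R h k :=
  exist _ (s (uU w), (path w, r (uV w))) (mem_set (e_in w)).
have ce : continuous e.
  apply: continuous_into_set_type; apply: continuous_pairing.
    exact: continuous_compose cuU cs.
  apply: continuous_pairing => //; exact: continuous_compose cuV cr.
pose mu w : I := clamp (3 * lam w - 1).
have cmu : continuous mu.
  apply: continuous_compose (@continuous_clamp R).
  apply: continuous_subr; last exact: continuous_const.
  by apply: continuous_mulr => //; exact: continuous_const.
have muL w : lam w <= 1 / 3 -> mu w = i0 R.
  by move=> ?; apply: clamp_le0; lra.
have muR w : 2 / 3 <= lam w -> mu w = i1 R.
  by move=> ?; apply: clamp_ge1; lra.
pose inl y : fjoin R h k := jpi (existT (join_piece R h k) (Some true) y).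
pose inr z : fjoin R h k := jpi (existT (join_piece R h k) (Some false) z).
pose inm m : fjoin R h k := jpi (existT (join_piece R h k) None m).
have cinl : continuous inl by exact: (continuous_compose
  (@existT_continuous _ (join_piece R h k) (Some true))
  (@continuous_jpi _ _ _ _ _ _ _)).
have cinr : continuous inr by exact: (continuous_compose
  (@existT_continuous _ (join_piece R h k) (Some false))
  (@continuous_jpi _ _ _ _ _ _ _)).
have cinm : continuous inm by exact: (continuous_compose
  (@existT_continuous _ (join_piece R h k) None)
  (@continuous_jpi _ _ _ _ _ _ _)).
(* Three clauses are imposed at once, so that each formula is available on an open set. They agree
   on overlaps: for [lam x <= 1 / 3] the parameter [mu x] is [0], where the join glues the cylinder
   to its [Y]-end, and likewise on the other side. *)
have phiP x : {q : fjoin R h k |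
    [/\ forall u : fsub U, val u = x -> lam x <= 1 / 3 -> q = inl (s u),
        forall v : fsub V, val v = x -> 2 / 3 <= lam x -> q = inr (r v) &
        forall w : set_type UV, val w = x -> q = inm (e w, mu x)]}.
  apply: cid; have [xL|xL] := lerP (lam x) (1 / 3).
    have Ux : U x by rewrite /U /=; lra.
    exists (inl (s (exist _ x (mem_set Ux) : fsub U))); split.
    - by move=> u ux _; congr (inl (s _)); apply: val_inj.
    - by move=> v _ xR; exfalso; lra.
    - move=> w wx; rewrite muL// /inm jpi_left; congr (inl (s _)).
      exact: val_inj.
  have [xR|xR] := lerP (2 / 3) (lam x).
    have Vx : V x by rewrite /V /=; lra.
    exists (inr (r (exist _ x (mem_set Vx) : fsub V))); split.
    - by move=> u _ xL'; exfalso; lra.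
    - by move=> v vx _; congr (inr (r _)); apply: val_inj.
    - move=> w wx; rewrite muR// /inm jpi_right; congr (inr (r _)).
      exact: val_inj.
  have UVx : UV x by split; rewrite /U /V /=; lra.
  exists (inm (e (exist _ x (mem_set UVx)), mu x)); split.
  - by move=> u _ xL'; exfalso; lra.
  - by move=> v _ xR'; exfalso; lra.
  - by move=> w wx; congr (inm (e _, _)); apply: val_inj.
pose phi x := sval (phiP x).
have phiL (u : fsub U) : lam (val u) <= 1 / 3 -> phi (val u) = inl (s u).
  by have [+ _ _] := svalP (phiP (val u)); apply.
have phiR (v : fsub V) : 2 / 3 <= lam (val v) -> phi (val v) = inr (r v).
  by have [_ + _] := svalP (phiP (val v)); apply.
have phiM (w : set_type UV) : phi (val w) = inm (e w, mu (val w)).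
  by have [_ _ +] := svalP (phiP (val w)); apply.
(* Linear interpolation from [mu x] to the midpoint. Where [mu x] is [0] it equals half of [t], and
   [th] at that time is [Hs] at [t]; where [mu x] is [1], [th] becomes [Hr] at [t]. So [th]
   continues the two given homotopies, which serve where [th] is undefined. *)
pose slide (x : W) (t : I) : I :=
  clamp ((1 - val t) * val (mu x) + val t * (1 / 2)).
have cslide : continuous (fun p : W * I => slide p.1 p.2).
  apply: continuous_compose (@continuous_clamp R).
  apply: continuous_addr; apply: continuous_mulr.
  - apply: continuous_subr; [exact: continuous_const|exact: cv].
  - exact: (continuous_compose (continuous_compose (@continuous_fst _ _) cmu)
      (@continuous_uI_val R)).
  - exact: cv.
  - exact: continuous_const.
have DP p : {d : K |
    [/\ forall u : fsub U, val u = p.1 -> lam p.1 <= 1 / 3 -> d = Hs (u, p.2),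
        forall v : fsub V, val v = p.1 -> 2 / 3 <= lam p.1 -> d = Hr (v, p.2) &
        forall w : set_type UV, val w = p.1 -> d = th (w, slide p.1 p.2)]}.
  case: p => x t /=; have t01 := uI_itv t.
  apply: cid; have [xL|xL] := lerP (lam x) (1 / 3).
    have Ux : U x by rewrite /U /=; lra.
    exists (Hs (exist _ x (mem_set Ux) : fsub U, t)); split.
    - by move=> u ux _; congr (Hs (_, _)); apply: val_inj.
    - by move=> v _ xR; exfalso; lra.
    - move=> w wx.
      have sE : val (slide x t) = val t * (1 / 2).
        by rewrite /slide muL// (_ : val (i0 R) = 0)// val_clamp; lra.
      rewrite thL ?sE; last lra.
      congr (Hs (_, _)); first exact: val_inj.
      by rewrite -[LHS]clamp_val; congr clamp; lra.
  have [xR|xR] := lerP (2 / 3) (lam x).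
    have Vx : V x by rewrite /V /=; lra.
    exists (Hr (exist _ x (mem_set Vx) : fsub V, t)); split.
    - by move=> u _ xL'; exfalso; lra.
    - by move=> v vx _; congr (Hr (_, _)); apply: val_inj.
    - move=> w wx.
      have sE : val (slide x t) = 1 - val t * (1 / 2).
        by rewrite /slide muR// (_ : val (i1 R) = 1)// val_clamp; lra.
      rewrite thR ?sE; last lra.
      congr (Hr (_, _)); first exact: val_inj.
      by rewrite -[LHS]clamp_val; congr clamp; lra.
  have UVx : UV x by split; rewrite /U /V /=; lra.
  exists (th (exist _ x (mem_set UVx), slide x t)); split.
  - by move=> u _ xL'; exfalso; lra.
  - by move=> v _ xR'; exfalso; lra.
  - by move=> w wx; congr (th (_, _)); apply: val_inj.
pose D p := sval (DP p).
have DL (u : fsub U) t : lam (val u) <= 1 / 3 -> D (val u, t) = Hs (u, t).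
  by have [+ _ _] := svalP (DP (val u, t)); apply.
have DR (v : fsub V) t : 2 / 3 <= lam (val v) -> D (val v, t) = Hr (v, t).
  by have [_ + _] := svalP (DP (val v, t)); apply.
have DM (w : set_type UV) t : D (val w, t) = th (w, slide (val w) t).
  by have [_ _ +] := svalP (DP (val w, t)); apply.
(* Together with [UV] these open sets cover [W], and on each of the three [phi] and [D] follow one
   continuous formula. *)
pose O1 := [set x | lam x < 1 / 3]; pose O3 := [set x | 2 / 3 < lam x].
have sub1 : O1 `<=` U by move=> x; rewrite /O1 /U /=; lra.
have sub3 : O3 `<=` V by move=> x; rewrite /O3 /V /=; lra.
have oO1 : open O1 by move/continuousP : clam => /(_ _ (@open_lt R (1 / 3))).
have oO3 : open O3 by move/continuousP : clam => /(_ _ (@open_gt R (2 / 3))).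
have oUV : open UV.
  by apply: openI; [move/continuousP : clam => /(_ _ (@open_lt R 1))
                   |move/continuousP : clam => /(_ _ (@open_gt R 0))].
have cases x : [\/ O1 x, O3 x | UV x].
  have [xL|xL] := ltrP (lam x) (1 / 3); first by constructor 1.
  have [xR|xR] := ltrP (2 / 3) (lam x); first by constructor 2.
  by constructor 3; split; rewrite /U /V /=; lra.
have v1 (y : set_type O1) : lam (val y) <= 1 / 3
  by apply: ltW; exact: set_mem (valP y).
have v3 (y : set_type O3) : 2 / 3 <= lam (val y)
  by apply: ltW; exact: set_mem (valP y).
pose i1U : set_type O1 -> fsub U := set_incl sub1.
pose i3V : set_type O3 -> fsub V := set_incl sub3.
have ci1U : continuous i1U by exact: continuous_set_incl.
have ci3V : continuous i3V by exact: continuous_set_incl.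
exists phi; split; first split.
- move=> x; case: (cases x) => Ox.
  + apply: (continuous_at_open oO1 Ox).
    have -> : (fun y : set_type O1 => phi (val y)) = (fun y => inl (s (i1U y))).
      by apply/funext => y; rewrite -phiL//; exact: v1.
    exact: (continuous_compose (continuous_compose ci1U cs) cinl).
  + apply: (continuous_at_open oO3 Ox).
    have -> : (fun y : set_type O3 => phi (val y)) = (fun y => inr (r (i3V y))).
      by apply/funext => y; rewrite -phiR//; exact: v3.
    exact: (continuous_compose (continuous_compose ci3V cr) cinr).
  + apply: (continuous_at_open oUV Ox).
    have -> : (fun y : set_type UV => phi (val y)) =
              (fun y => inm (e y, mu (val y))).
      by apply/funext => y; rewrite -phiM.
    apply: (continuous_compose2 cinm) => //.
    exact: (continuous_compose (@continuous_set_val _ UV) cmu).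
- move=> x; case: (cases x) => Ox.
  + have xL := v1 (exist _ x (mem_set Ox)).
    rewrite (phiL (i1U (exist _ x (mem_set Ox))))// fsp_proj_jpi.
    exact: ps.
  + have xR := v3 (exist _ x (mem_set Ox)).
    rewrite (phiR (i3V (exist _ x (mem_set Ox))))// fsp_proj_jpi.
    exact: pr.
  + by rewrite (phiM (exist _ x (mem_set Ox))) fsp_proj_jpi.
- exists D; split.
  + case=> x t; case: (cases x) => Ox.
    * apply: (continuous_at_open_prod oO1) => //.
      have -> : (fun y : set_type O1 * I => D (val y.1, y.2)) =
                (fun y => Hs (i1U y.1, y.2)).
        by apply/funext => y; rewrite -DL//; exact: v1.
      apply: (continuous_compose2 cHs).
        exact: (continuous_compose (@continuous_fst _ _) ci1U).
      exact: continuous_snd.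
    * apply: (continuous_at_open_prod oO3) => //.
      have -> : (fun y : set_type O3 * I => D (val y.1, y.2)) =
                (fun y => Hr (i3V y.1, y.2)).
        by apply/funext => y; rewrite -DR//; exact: v3.
      apply: (continuous_compose2 cHr).
        exact: (continuous_compose (@continuous_fst _ _) ci3V).
      exact: continuous_snd.
    * apply: (continuous_at_open_prod oUV) => //.
      have -> : (fun y : set_type UV * I => D (val y.1, y.2)) =
                (fun y => th (y.1, slide (val y.1) y.2)).
        by apply/funext => y; rewrite -DM.
      apply: (continuous_compose2 cth).
        exact: continuous_fst.
      apply: (@continuous_compose _ _ _
        (fun y : set_type UV * I => (val y.1, y.2)) _ _ cslide).
      apply: continuous_pairing; last exact: continuous_snd.
      exact: (continuous_compose (@continuous_fst _ _)
        (@continuous_set_val _ UV)).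
  + move=> x t; case: (cases x) => Ox.
    * have xL := v1 (exist _ x (mem_set Ox)).
      by rewrite (DL (i1U (exist _ x (mem_set Ox))))// pHs.
    * have xR := v3 (exist _ x (mem_set Ox)).
      by rewrite (DR (i3V (exist _ x (mem_set Ox))))// pHr.
    * by rewrite (DM (exist _ x (mem_set Ox))) pth.
  + move=> x; case: (cases x) => Ox.
    * have xL := v1 (exist _ x (mem_set Ox)).
      rewrite (DL (i1U (exist _ x (mem_set Ox))))// Hs0.
      by rewrite (phiL (i1U (exist _ x (mem_set Ox))))// join_mapE.
    * have xR := v3 (exist _ x (mem_set Ox)).
      rewrite (DR (i3V (exist _ x (mem_set Ox))))// Hr0.
      by rewrite (phiR (i3V (exist _ x (mem_set Ox))))// join_mapE.
    * rewrite (DM (exist _ x (mem_set Ox))) (phiM (exist _ x (mem_set Ox))).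
      rewrite join_mapE [RHS]/=; congr (th (_, _)); rewrite /slide /=.
      rewrite -[RHS]clamp_val /=; congr clamp.
      by rewrite subr0 mul1r mul0r addr0.
  + move=> x; case: (cases x) => Ox.
    * have xL := v1 (exist _ x (mem_set Ox)).
      by rewrite (DL (i1U (exist _ x (mem_set Ox))))// Hs1.
    * have xR := v3 (exist _ x (mem_set Ox)).
      by rewrite (DR (i3V (exist _ x (mem_set Ox))))// Hr1.
    * rewrite (DM (exist _ x (mem_set Ox))).
      have sE : val (slide x (i1 R)) = 1 / 2.
        by rewrite /slide val_clamp /=; lra.
      by rewrite thL ?sE// clamp_ge1 ?Hs1//; lra.
Qed.

End JoinGluing.

(** * Fibrewise products and the diagonal *)

Section FibrewiseProduct.
Import Pilot.Defs.
Variables (R : realType) (B : topologicalType).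

Lemma fibrewise_fprod_fst (X Y : fsp B) :
  fibrewise_map (fun p : fprod X Y => (val p).1).
Proof.
split=> //.
exact: (continuous_compose (@continuous_set_val _ (@fprod_set B X Y))
  (@continuous_fst _ _)).
Qed.

Lemma fibrewise_fprod_snd (X Y : fsp B) :
  fibrewise_map (fun p : fprod X Y => (val p).2).
Proof.
split; last by move=> p; rewrite -fprod_setP.
exact: (continuous_compose (@continuous_set_val _ (@fprod_set B X Y))
  (@continuous_snd _ _)).
Qed.

Lemma continuous_into_fprod (T : topologicalType) (X Y : fsp B)
    (g : T -> fprod X Y) :
  continuous (fun x => (val (g x)).1) -> continuous (fun x => (val (g x)).2) ->
  continuous g.
Proof.
move=> c1 c2; apply: continuous_into_set_type.
have -> : (fun x => val (g x)) = (fun x => ((val (g x)).1, (val (g x)).2)).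
  by apply/funext => x; rewrite -surjective_pairing.
exact: continuous_pairing.
Qed.

Lemma continuous_fhom_times_id (X Y P : fsp B) (g : fhom X Y) :
  continuous g -> continuous (fhom_times_id_fhom P g).
Proof.
move=> cg; apply: continuous_into_fprod.
  exact: (continuous_compose (fibrewise_fprod_fst X P).1 cg).
exact: (fibrewise_fprod_snd X P).1.
Qed.

Lemma continuous_id_times_fhom (P X Y : fsp B) (g : fhom X Y) :
  continuous g -> continuous (id_times_fhom_fhom P g).
Proof.
move=> cg; apply: continuous_into_fprod.
  exact: (fibrewise_fprod_fst P X).1.
exact: (continuous_compose (fibrewise_fprod_snd P X).1 cg).
Qed.

(** The recursion in [diag_sig] carries a proof along, so this equation appears only after
    destructing the smaller diagonal. *)
Lemma val_diagS (X : fsp B) n (x : X) :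
  val (diag n.+1 x) = (x, diag n x).
Proof. by rewrite /diag /=; case: diag_sig. Qed.

Lemma fibrewise_diag (X : fsp B) n : fibrewise_map (@diag B X n).
Proof.
elim: n => [|n [cd pd]]; first exact: fibrewise_map_id.
split; last by move=> x; rewrite /fsp_proj /= val_diagS.
apply: continuous_into_fprod.
  have -> : (fun x => (val (diag n.+1 x)).1) = (fun x : X => x).
    by apply/funext => x; rewrite val_diagS.
  exact: continuous_ident.
have -> : (fun x : X => (val (diag n.+1 x)).2) = @diag B X n.
  by apply/funext => x; rewrite val_diagS.
exact: cd.
Qed.

(** Only the first coordinate moves: the second coordinate of [g] is kept fixed in the lift and
    throughout the homotopy. Since both preserve projections, the pairs stay in the fibrewise
    product. *)
Lemma flift_times_id (W X Y P : fsp B) (h : fhom Y X) (g : W -> fprod X P) :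
  fibrewise_map g -> flift R h (fun w => (val (g w)).1) ->
  flift R (fhom_times_id_fhom P h) g.
Proof.
move=> [cg pg] [s [[cs ps] [H [cH pH H0 H1]]]].
have cg2 := continuous_compose cg (fibrewise_fprod_snd X P).1.
have pg2 w : fsp_proj P (val (g w)).2 = fsp_proj W w.
  by rewrite -fprod_setP -pg.
have sP w : fprod_set (s w, (val (g w)).2) by rewrite /fprod_set /= ps pg2.
have HP p : fprod_set (H p, (val (g p.1)).2).
  by case: p => w t; rewrite /fprod_set /= pH pg2.
exists (fun w => exist _ (s w, (val (g w)).2) (mem_set (sP w)) : fprod Y P).
split; first by split=> //; exact: continuous_into_fprod.
exists (fun p => exist _ (H p, (val (g p.1)).2) (mem_set (HP p)) : fprod X P).
split.
- apply: continuous_into_fprod => //.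
  exact: (continuous_compose (@continuous_fst _ _) cg2).
- by move=> w t; exact: pH.
- by move=> w; apply: val_inj; rewrite /= H0.
- by move=> w; apply: val_inj; rewrite /= H1 -surjective_pairing.
Qed.

Lemma flift_id_times (W X Y P : fsp B) (h : fhom Y X) (g : W -> fprod P X) :
  fibrewise_map g -> flift R h (fun w => (val (g w)).2) ->
  flift R (id_times_fhom_fhom P h) g.
Proof.
move=> [cg pg] [s [[cs ps] [H [cH pH H0 H1]]]].
have cg1 := continuous_compose cg (fibrewise_fprod_fst P X).1.
have sP w : fprod_set ((val (g w)).1, s w).
  by rewrite /fprod_set /= ps; exact: pg.
have HP p : fprod_set ((val (g p.1)).1, H p).
  by case: p => w t; rewrite /fprod_set /= pH; exact: pg.
exists (fun w => exist _ ((val (g w)).1, s w) (mem_set (sP w)) : fprod P Y).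
split.
  by split; [exact: continuous_into_fprod|move=> w; exact: pg].
exists (fun p => exist _ ((val (g p.1)).1, H p) (mem_set (HP p)) : fprod P X).
split.
- apply: continuous_into_fprod => //.
  exact: (continuous_compose (@continuous_fst _ _) cg1).
- by move=> w t; exact: pg.
- by move=> w; apply: val_inj; rewrite /= H0.
- by move=> w; apply: val_inj; rewrite /= H1 -surjective_pairing.
Qed.

End FibrewiseProduct.

(** * From lifts to open covers *)

Section Covers.
Import Pilot.Defs.
Variables (R : realType) (B : topologicalType) (E X : fsp B) (f : fhom E X).
Hypothesis cf : continuous f.

Lemma continuous_fat_wedge_map n : continuous (fat_wedge_map R f n).
Proof.
elim: n => [//|n IH]; apply: continuous_join_map.
  exact: continuous_fhom_times_id.
exact: continuous_id_times_fhom.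
Qed.

Lemma continuous_ganea_map n : continuous (ganea_map R f n).
Proof. by elim: n => [//|n IH]; exact: continuous_join_map. Qed.

(** For the identity of [X] this is [secat_le]. An arbitrary [a] is allowed because peeling off a
    join passes to an open subspace of the source. *)
Definition lift_cover n (W : fsp B) (a : W -> X) :=
  exists U : 'I_n.+1 -> set W,
    (forall i, open (U i) /\ flift R f (fun w : fsub (U i) => a (val w))) /\
    \bigcup_i U i = setT.

Lemma lift_cover0 (W : fsp B) (a : W -> X) : flift R f a -> lift_cover 0 a.
Proof.
move=> fa; exists (fun=> setT); split; last first.
  by apply/seteqP; split=> // w _; exists ord0.
move=> _; split; first exact: openT.
exact: (flift_comp (@fibrewise_map_val _ _ setT) fa).
Qed.

Lemma lift_coverS n (W : fsp B) (a : W -> X) (U V : set W) :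
  open U -> open V -> (forall w, U w \/ V w) ->
  flift R f (fun w : fsub U => a (val w)) ->
  lift_cover n (fun w : fsub V => a (val w)) -> lift_cover n.+1 a.
Proof.
move=> oU oV UV fU [P [oP coverP]].
(* Index [0] gets [U]; index [j + 1] gets the member [P j] of the cover of [V], viewed in [W], where
   it is open because [V] is. *)
exists (fun i => if unlift ord0 i is Some j then val @` P j else U); split.
  move=> i; case: unlift => [j|//]; have [oPj fPj] := oP j; split.
    rewrite openE => _ [v Pv <-]; apply: open_set_val_image => //.
    exact: open_nbhs_nbhs.
  exact: flift_sub_sub.
apply/seteqP; split=> // w _; have [Uw|Vw] := UV w.
  by exists ord0 => //; rewrite unlift_none.
pose v : fsub V := exist _ w (mem_set Vw).
have : (\bigcup_i P i) v by rewrite coverP.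
move=> [j _ Pv]; exists (lift ord0 j) => //; rewrite liftK.
by exists v.
Qed.

(** On the first set of the splitting, the first coordinate of the diagonal, which is [a], lifts
    through [f]. On the second set the second coordinate is the smaller diagonal and lifts through
    the smaller fat wedge, so induction applies. *)
Lemma lift_cover_fat_wedge n (W : fsp B) (a : W -> X) :
  flift R (fat_wedge_map R f n) (fun w => diag n (a w)) ->
  lift_cover n a.
Proof.
elim: n W a => [|n IH] W a; first exact: lift_cover0.
move=> /(flift_join_split (continuous_fhom_times_id (P := fprodn X n) cf)
  (continuous_id_times_fhom (P := X) (@continuous_fat_wedge_map n))).
move=> [U [oU UV fU]].
apply: (lift_coverS (oU true) (oU false) UV).
  have := flift_map (fibrewise_fprod_fst X (fprodn X n))
    (fibrewise_fprod_fst E (fprodn X n)) (k := f) _ (fU true).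
  move=> /(_ (fun=> erefl)); congr (flift R f _).
  by apply/funext => w; rewrite val_diagS.
apply: IH.
have := flift_map (fibrewise_fprod_snd X (fprodn X n))
  (fibrewise_fprod_snd X (fat_wedge R f n)) (k := fat_wedge_map R f n) _
  (fU false).
move=> /(_ (fun=> erefl)); congr (flift R _ _).
by apply/funext => w; rewrite val_diagS.
Qed.

Lemma lift_cover_ganea n (W : fsp B) (a : W -> X) :
  flift R (ganea_map R f n) a -> lift_cover n a.
Proof.
elim: n W a => [|n IH] W a; first exact: lift_cover0.
move=> /(flift_join_split (@continuous_ganea_map n) cf) [U [oU UV fU]].
(* In the Ganea join [f] is the second factor, so the [false] set is split off and the [true] set
   goes to the induction. *)
apply: (lift_coverS (oU false) (oU true)).
  by move=> w; case: (UV w); [right|left].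
  exact: (fU false).
exact/IH/(fU true).
Qed.

End Covers.

(** * From open covers to lifts over a normal space *)

Section NormalCovers.
Import Order.TTheory GRing.Theory Num.Theory.
Local Open Scope ring_scope.
Variables (R : realType) (B : topologicalType) (E X : fsp B) (f : fhom E X).
Hypothesis cX : continuous (fsp_proj X).
Hypothesis normalX : normal_space (fsp_car X).

(** A Urysohn function is taken that is [0] on [C] minus [V] and [1] on [C] minus [U]; these closed
    sets are disjoint because [U] and [V] cover [C]. *)
Lemma normal_shrink (T : topologicalType) (C U V : set T) :
  normal_space T -> closed C -> open U -> open V -> C `<=` U `|` V ->
  exists (lam : T -> R) (C' : set T),
    [/\ continuous lam, closed C', C' `<=` U,
        (forall x, C x -> lam x < 1 -> C' x) &
        (forall x, C x -> 0 < lam x -> V x)].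
Proof.
move=> nT cC oU oV CUV.
have [|||g [cg g0 g1 _]] := @urysohn_ext_itv T R nT
    (C `&` ~` V) (C `&` ~` U) 0 1 _ _ _ ltr01.
- by apply: closedI => //; exact: open_closedC.
- by apply: closedI => //; exact: open_closedC.
- by apply/seteqP; split=> // x [[Cx Vx] [_ Ux]]; case: (CUV _ Cx).
(* The factor [3 / 2] turns [lam x < 1] into [g x < 2 / 3]. This leaves room for the closed set
   [C'], still inside [U] since [g] is [1] on [C] minus [U]. *)
exists (fun x => 3 / 2 * g x), (C `&` [set x | g x <= 2 / 3]); split.
- apply: continuous_mulr => //; exact: continuous_const.
- apply: closedI => //.
  by move/continuous_closedP : cg => /(_ _ (@closed_le R (2 / 3))).
- move=> x [Cx /= gx]; apply: contrapT => Ux.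
  by have : g x = 1 by [apply: g1; exists x]; lra.
- by move=> x Cx gx; split=> //=; lra.
- move=> x Cx gx; apply: contrapT => Vx.
  by have : g x = 0 by [apply: g0; exists x]; lra.
Qed.

Lemma flift_restrict (Y K : fsp B) (h : Y -> K) (G : X -> K) (A C : set X)
    (D : set (fsub C)) :
  (forall w, D w -> A (val w)) -> flift R h (fun x : fsub A => G (val x)) ->
  flift R h (fun w : fsub D => G (val (val w))).
Proof.
move=> DA; have inA (w : fsub D) : A (val (val w)).
  exact: DA (set_mem (valP w)).
pose a (w : fsub D) : fsub A := exist _ (val (val w)) (mem_set (inA w)).
apply: (@flift_comp R B (fsub A) (fsub D) Y K h (fun x => G (val x)) a).
split=> //; apply: continuous_into_set_type.
exact: (continuous_compose (@continuous_set_val _ D) (@continuous_set_val _ C)).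
Qed.

Lemma open_bigcup_lift n (U : 'I_n.+2 -> set X) :
  (forall i, open (U i)) -> open (\bigcup_j U (lift ord0 j)).
Proof. by move=> oU; apply: bigcup_open. Qed.

Lemma sub_bigcup_lift n (U : 'I_n.+2 -> set X) (C : set X) :
  C `<=` \bigcup_i U i -> C `<=` (\bigcup_j U (lift ord0 j)) `|` U ord0.
Proof.
move=> CU x /CU [i _ Ui]; case: (unliftP ord0 i) Ui => [j ->|->] Ui.
  by left; exists j.
by right.
Qed.

Lemma continuous_fsub_proj (C : set X) : continuous (fsp_proj (fsub C)).
Proof. exact: (continuous_compose (@continuous_set_val _ C) cX). Qed.

(** The union of the later sets contains a closed [C'] to which the induction hypothesis applies,
    and [U ord0] lifts through [f], the second factor of the join. The function [lam] is built on
    all of [X], where normality is available, and then restricted to [C]. *)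
Lemma ganea_lift_closed n (U : 'I_n.+1 -> set X) (C : set X) :
  closed C -> (forall i, open (U i)) ->
  (forall i, flift R f (fun u : fsub (U i) => val u : X)) ->
  C `<=` \bigcup_i U i ->
  flift R (ganea_map R f n) (fun u : fsub C => val u : X).
Proof.
elim: n U C => [|n IH] U C cC oU fU CU.
  have CU0 : C `<=` U ord0 by move=> x /CU [i _]; rewrite ord1.
  apply: (@flift_comp R B (fsub (U ord0)) (fsub C) _ _ f _ (set_incl CU0) _
    (fU ord0)).
  by split=> //; exact: continuous_set_incl.
have [lam [C' [clam cC' C'U lt1 gt0]]] := normal_shrink normalX cC
  (open_bigcup_lift oU) (oU ord0) (sub_bigcup_lift CU).
have fC' := IH (fun j => U (lift ord0 j)) C' cC' (fun j => oU _)
  (fun j => fU _) C'U.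
apply: (@flift_join_glue R B _ _ _ _ _ _ _ (fun w : fsub C => lam (val w))).
- exact: continuous_fsub_proj.
- exact: (continuous_compose (@continuous_set_val _ C) clam).
- apply: (flift_restrict (G := fun x => x) _ fC') => w; apply: lt1.
  exact: set_mem (valP w).
- apply: (flift_restrict (G := fun x => x) _ (fU ord0)) => w; apply: gt0.
  exact: set_mem (valP w).
Qed.

(** [U ord0] supplies a lift of the first coordinate of the diagonal and the inductive lift over
    [C'] one of the second; the other coordinate is carried along unchanged each time. *)
Lemma fat_wedge_lift_closed n (U : 'I_n.+1 -> set X) (C : set X) :
  closed C -> (forall i, open (U i)) ->
  (forall i, flift R f (fun u : fsub (U i) => val u : X)) ->
  C `<=` \bigcup_i U i ->
  flift R (fat_wedge_map R f n) (fun u : fsub C => diag n (val u : X)).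
Proof.
elim: n U C => [|n IH] U C cC oU fU CU.
  have CU0 : C `<=` U ord0 by move=> x /CU [i _]; rewrite ord1.
  apply: (@flift_comp R B (fsub (U ord0)) (fsub C) _ _ f _ (set_incl CU0) _
    (fU ord0)).
  by split=> //; exact: continuous_set_incl.
have [lam [C' [clam cC' C'U lt1 gt0]]] := normal_shrink normalX cC
  (open_bigcup_lift oU) (oU ord0) (sub_bigcup_lift CU).
have fC' := IH (fun j => U (lift ord0 j)) C' cC' (fun j => oU _)
  (fun j => fU _) C'U.
have fdiag (A : set X) :
    fibrewise_map (fun u : fsub A => diag n.+1 (val u : X)).
  exact: (fibrewise_map_comp (@fibrewise_map_val _ _ A)
    (@fibrewise_diag _ X n.+1)).
(* The factor built from [f] comes first in the fat wedge, so the separating function is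
   reversed. *)
apply: (@flift_join_glue R B _ _ _ _ _ _ _ (fun w : fsub C => 1 - lam (val w))).
- exact: continuous_fsub_proj.
- apply: continuous_subr; first exact: continuous_const.
  exact: (continuous_compose (@continuous_set_val _ C) clam).
- apply: (flift_restrict (A := U ord0)).
    by move=> w /= w1; apply: gt0; [exact: set_mem (valP w)|lra].
  apply: flift_times_id; first exact: fdiag.
  have := fU ord0; congr (flift R f _).
  by apply/funext => u; rewrite val_diagS.
- apply: (flift_restrict (A := C')).
    by move=> w /= w1; apply: lt1; [exact: set_mem (valP w)|lra].
  apply: flift_id_times; first exact: fdiag.
  move: fC'; congr (flift R _ _).
  by apply/funext => u; rewrite val_diagS.
Qed.

(** The induction over closed sets ends at the full subset, whose subspace is a different type from
    [X]. *)
Lemma flift_setT (Y K : fsp B) (h : Y -> K) (G : X -> K) :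
  flift R h (fun u : fsub [set: X] => G (val u)) -> flift R h G.
Proof.
pose a (x : X) : fsub [set: X] := exist _ x (mem_set I).
apply: (@flift_comp R B _ _ _ _ h _ a); split=> //.
by apply: continuous_into_set_type; exact: continuous_ident.
Qed.

End NormalCovers.

(** * Equivalence of the three conditions *)

Unset Implicit Arguments.

Theorem theorem2p7 (R : realType) (B : topologicalType) (E X : fsp B)
    (f : fhom E X) :
  continuous (@fsp_proj B E) -> continuous (@fsp_proj B X) -> continuous f ->
  ((normal_space (fsp_car E) /\ normal_space (fsp_car X)) \/
   (closed_fcofibration R (f : E -> X) /\ normal_space (fsp_car X))) ->
  forall n : nat,
    (secat_le R f n <->
       exists phi : X -> fat_wedge R f n,
         fibrewise_map phi /\
         fhtpy R (fun x => fat_wedge_map R f n (phi x)) (@diag B X n)) /\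
    (secat_le R f n <->
       exists sigma : X -> ganea_space R f n,
         fibrewise_map sigma /\
         fhtpy R (fun x => ganea_map R f n (sigma x)) id).
Proof.
move=> _ cX cf hyp n.
have nX : normal_space (fsp_car X) by case: hyp => [[]|[]].
split; split.
- move=> [U [oU UT]].
  apply: (flift_setT (h := fat_wedge_map R f n)).
  apply: (fat_wedge_lift_closed cX nX closedT (fun i => (oU i).1)
    (fun i => (oU i).2)).
  by rewrite UT.
(* The existence statement unfolds from [flift], and for the identity [lift_cover] unfolds to
   [secat_le]. *)
- exact: (lift_cover_fat_wedge cf (a := fun x : X => x)).
- move=> [U [oU UT]].
  apply: (flift_setT (h := ganea_map R f n)).
  apply: (ganea_lift_closed cX nX closedT (fun i => (oU i).1)
    (fun i => (oU i).2)).
  by rewrite UT.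
- exact: (lift_cover_ganea cf (a := fun x : X => x)).
Qed.
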